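(* Let $m$ be a positive integer and $q=2^m$. Then $$f(x)=x+x^{2q^2+2q}+x^{2q^2+2}+x^{4}+x^{4q}$$ is a permutation polynomial over $\mathbb{F}_{q^3}$ if and only if $m\not\equiv 1\pmod 3$.
   Context: $\mathbb{F}_{q^3}$ denotes the finite field with $q^3$ elements. A polynomial $f\in\mathbb{F}_{q^3}[x]$ is a permutation polynomial over $\mathbb{F}_{q^3}$ if the associated map $c\mapsto f(c)$ from $\mathbb{F}_{q^3}$ to itself is a bijection. *)

(* Defs.v *)
From mathcomp Require Import all_boot all_algebra.
Set Implicit Arguments.
Unset Strict Implicit.
Unset Printing Implicit Defensive.
Import GRing.Theory.
Local Open Scope ring_scope.

Definition permutation_poly (F : finFieldType) (p : {poly F}) : Prop :=
  bijective (fun c : F => p.[c]).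

(* Main.v *)
(* Write T(x) = x + x^q + x^(q^2). In characteristic 2,
   f(x) = x + ((x + x^q) T(x))^2, hence T(f(x)) = T(x). If f(x) = f(y) with
   x <> y, put t = T(x) = T(y) and e = t^2 (x - y); then T(e) = 0 and
   e^q = e^2, so e + e^2 + e^4 = 0 and e lies in F_8, where e^q = e^2 forces
   m = 1 mod 3. Conversely, if m = 1 mod 3, a root e of X^3 + X + 1 in F_8
   satisfies f(1 + e) = f(1). *)
Require Import Defs.
From mathcomp Require Import all_boot all_algebra.
From mathcomp Require Import all_fingroup all_solvable all_field ring.
Set Implicit Arguments.
Unset Strict Implicit.
Unset Printing Implicit Defensive.
Import GRing.Theory.
Local Open Scope ring_scope.

Definition rel_trace (R : pzSemiRingType) (q : nat) (x : R) : R :=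
  x + x ^+ q + x ^+ (q ^ 2).

(* [ring] does not reduce coefficients modulo 2: [c] certifies that reduction, and
   [k] the use of the hypothesis [u = v]. *)
Lemma lincomb_pchar2 (R : comNzRingType) (k c u v a b : R) :
  2%N \in [pchar R] -> u = v -> a - b = k * (u - v) + c *+ 2 -> a = b.
Proof.
move=> char2 ->; rewrite subrr mulr0 add0r mulrn_pchar // => /eqP.
by rewrite subr_eq0 => /eqP.
Qed.

(** With y = x^q and z = x^(q^2), the product (x + y)(x + y + z) is (x + y)^2 + xz + yz, and
    squaring is additive in characteristic 2. *)
Lemma horner_trace_form (R : comNzRingType) (q : nat) (x : R) :
  2%N \in [pchar R] ->
  ('X + 'X^(2 * q ^ 2 + 2 * q) + 'X^(2 * q ^ 2 + 2) + 'X^4 + 'X^(4 * q)).[x]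
  = x + ((x + x ^+ q) * rel_trace q x) ^+ 2.
Proof.
move=> char2.
rewrite /rel_trace !hornerD hornerX !hornerXn.
rewrite (mulnC 2%N (q ^ 2)%N) (mulnC 2%N q) (mulnC 4%N q).
rewrite (exprD _ (_ * 2)%N (_ * 2)%N) (exprD _ (_ * 2)%N 2%N) !exprM.
set y := x ^+ q; set z := y ^+ q; set s := x + y.
apply: (@lincomb_pchar2 _ 0
  (- (s ^+ 3 * z + 2 * x ^+ 3 * y + 3 * x ^+ 2 * y ^+ 2 + 2 * x * y ^+ 3
      + x * y * z ^+ 2)) 0 0) => //.
by rewrite /s; ring.
Qed.

(** The equation [e ^+ 8 = e] encodes membership in F_8, where squaring three times is the
    identity. *)
Lemma expf_pow8 (R : pzSemiRingType) (e : R) (k : nat) :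
  e ^+ 8 = e -> e ^+ (2 ^ (3 * k)) = e.
Proof.
by move=> e8; elim: k => [|k IHk]; rewrite ?expr1 // mulnS expnD exprM e8.
Qed.

Lemma expf_pow2_mod3 (R : pzSemiRingType) (e : R) (m : nat) :
  e ^+ 8 = e -> e ^+ (2 ^ m) = e ^+ (2 ^ (m %% 3)).
Proof.
by move=> e8; rewrite {1}(divn_eq m 3) mulnC expnD exprM expf_pow8.
Qed.

Section CubicExtension.

Variables (m : nat) (F : finFieldType).
Let q := (2 ^ m)%N.
Hypothesis (cardF : #|F| = (q ^ 3)%N).

Let tr : F -> F := rel_trace q.

Lemma pchar2_cubic : 2%N \in [pchar F].
Proof.
by apply: (@card_finPcharP F 2 (m * 3)) => //; rewrite cardF expnM.
Qed.

Let char2 := pchar2_cubic.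

Lemma exprqD (x y : F) : (x + y) ^+ q = x ^+ q + y ^+ q.
Proof. by rewrite exprDn_pchar // pnatX pnatE // char2. Qed.

Lemma exprqqq (x : F) : x ^+ q ^+ q ^+ q = x.
Proof. by rewrite -!exprM -[RHS]expf_card cardF !expnS expn0 muln1 mulnA. Qed.

Lemma trE (x : F) : tr x = x + x ^+ q + x ^+ q ^+ q.
Proof. by rewrite /tr /rel_trace -exprM. Qed.

Lemma tr_fixed (x : F) : tr x ^+ q = tr x.
Proof. by rewrite trE !exprqD exprqqq; ring. Qed.

Lemma trD (x y : F) : tr (x + y) = tr x + tr y.
Proof. by rewrite !trE !exprqD; ring. Qed.

(** Since [tr x] is fixed by the q-th power, the squared term has trace ([tr x] * tr (x + x^q))^2,
    and tr (x + x^q) = 2 [tr x] = 0. *)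
Lemma trace_form_tr (x : F) : tr (x + ((x + x ^+ q) * tr x) ^+ 2) = tr x.
Proof.
have sq (y : F) : y ^+ 2 ^+ q = y ^+ q ^+ 2 by rewrite exprAC.
rewrite trD [X in _ + X]trE !(sq, exprMn, tr_fixed, exprqD, exprqqq).
move: (tr x) (x ^+ q) (x ^+ q ^+ q) => t y z.
apply: (@lincomb_pchar2 _ 0
  (t ^+ 2 * (x ^+ 2 + y ^+ 2 + z ^+ 2 + x * y + y * z + z * x)) 0 0) => //.
by ring.
Qed.

Lemma frobenius_square_witness (x y : F) :
    x + ((x + x ^+ q) * tr x) ^+ 2 = y + ((y + y ^+ q) * tr y) ^+ 2 ->
    x != y ->
  exists2 e : F, e != 0 & tr e = 0 /\ e ^+ q = e ^+ 2.
Proof.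
move=> fxy neq_xy.
have tE : tr x = tr y by rewrite -trace_form_tr fxy trace_form_tr.
have tt := tr_fixed x.
move: tt fxy; rewrite -tE; move tx: (tr x) => t in tE * => tq fxy.
pose d := x + y.
have d0 : d != 0.
  by apply: contra neq_xy; rewrite /d addr_eq0 oppr_pchar2.
have trd : tr d = 0 by rewrite trD tx -tE addrr_pchar2.
(* Equal values give d = (t (d + d^q))^2, and trace zero turns d + d^q into d^(q^2). *)
have dE : d = (t * d ^+ q ^+ q) ^+ 2.
  have -> : d ^+ q ^+ q = d + d ^+ q.
    apply/eqP; rewrite -[X in _ == X](oppr_pchar2 char2) -addr_eq0 addrC.
    by rewrite -trE trd.
  rewrite /d exprqD.
  apply: (@lincomb_pchar2 _ 1 (y - ((x + x ^+ q) * t) ^+ 2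
    - t ^+ 2 * (x + x ^+ q) * (y + y ^+ q)) _ _ _ _ char2 fxy).
  by move: (x ^+ q) (y ^+ q) => x' y'; ring.
have t0 : t != 0.
  by apply: contra d0 => /eqP t0; rewrite dE t0 mul0r expr0n.
exists (t ^+ 2 * d); first by rewrite mulf_neq0 ?expf_neq0.
have tq2 : t ^+ 2 ^+ q = t ^+ 2 by rewrite exprAC tq.
split.
  move: (t ^+ 2) tq2 => u uq.
  by rewrite trE !exprMn !uq -!mulrDr -trE trd mulr0.
(* The q-th power of [dE] reads d^q = (t d)^2, because d^(q^3) = d; hence e^q = t^2 d^q = t^4 d^2 =
   e^2. *)
rewrite (exprMn _ (t ^+ 2)) tq2 {1}dE exprAC (exprMn _ t) tq exprqqq.
by ring.
Qed.

(** Applying e^q = e^2 three times gives e^8 = e^(q^3) = e, so e^q depends only on m mod 3. Residue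
    0 gives e^2 = e and residue 2 gives e^4 = e^2; either one reduces e + e^2 + e^4 to e, which is
    nonzero. *)
Lemma frobenius_square_mod3 (e : F) :
  e != 0 -> tr e = 0 -> e ^+ q = e ^+ 2 -> (m = 1 %[mod 3])%N.
Proof.
move=> e0 tre eq2.
have eqq : e ^+ q ^+ q = e ^+ 4 by rewrite eq2 exprAC eq2 -exprM.
have e8 : e ^+ 8 = e by rewrite -[RHS]exprqqq eqq exprAC eq2 -exprM.
have tr0 : e + e ^+ 2 + e ^+ 4 = 0 by rewrite -tre trE eqq eq2.
move: eq2; rewrite /q (expf_pow2_mod3 _ e8).
case: (m %% 3)%N (ltn_pmod m (isT : 0 < 3)%N) => [|[|[|]]] //= _ er.
- have e4 : e ^+ 4 = e by rewrite (exprM e 2 2) -er -er.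
  by case/eqP: e0; rewrite -tr0 e4 -er addrr_pchar2 // add0r.
- by case/eqP: e0; rewrite -tr0 -addrA er addrr_pchar2 // addr0.
Qed.

Lemma exists_root_F8 : exists2 e : F, e != 0 & e ^+ 3 + e + 1 = 0.
Proof.
(* The unit group has order 8^m - 1, and 8 = 1 mod 7. *)
have /(Cauchy (isT : prime 7)) [u _ ou] : (7 %| #|[set: {unit F}]|)%N.
  rewrite card_finField_unit cardF -expnM mulnC expnM -subn1.
  by rewrite -(eqn_mod_dvd 7) ?expn_gt0 // -modnXm exp1n.
set a := val u.
have a0 : a != 0 by rewrite -unitfE (valP u).
have a7 : a ^+ 7 = 1 by rewrite -FinRing.val_unitX -ou expg_order.
have a1 : a != 1.
  apply/eqP => a1; have u1 : u = 1%g by apply: val_inj.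
  by rewrite u1 order1 in ou.
(* This is the factorization of X^7 - 1 over F_2, evaluated at [a]. *)
have /eqP : (a + 1) * ((a ^+ 3 + a + 1) * (a ^+ 3 + a ^+ 2 + 1)) = 0.
  apply: (@lincomb_pchar2 _ 1 (a ^+ 6 + a ^+ 5 + 2 * a ^+ 4 + 2 * a ^+ 3
    + a ^+ 2 + a + 1) _ _ _ _ char2 a7).
  by ring.
rewrite !mulf_eq0 addr_eq0 oppr_pchar2 // (negPf a1) /=.
case/orP => /eqP ar; first by exists a.
(* The two cubics are reciprocal, so inversion carries roots of one to roots of the other. *)
exists a^-1; first by rewrite invr_eq0.
have -> : a^-1 ^+ 3 + a^-1 + 1 = (a ^+ 3 + a ^+ 2 + 1) / a ^+ 3 by field.
by rewrite ar mul0r.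
Qed.

(** Here tr e = 0 and tr 1 = 3 = 1, so the two values differ by e + (e + e^q)^2 = e + e^2 + e^4 = e
    (e^3 + e + 1) = 0. *)
Lemma trace_form_collision :
    (m = 1 %[mod 3])%N ->
  exists2 e : F, e != 0 &
    (1 + e) + (((1 + e) + (1 + e) ^+ q) * tr (1 + e)) ^+ 2
    = 1 + ((1 + 1 ^+ q) * tr 1) ^+ 2.
Proof.
move=> m1; have [e e0 eR] := exists_root_F8.
exists e => //.
have e8 : e ^+ 8 = e.
  (* The multiplier is the cofactor of e^3 + e + 1 in e^8 - e modulo 2. *)
  apply: (@lincomb_pchar2 _ (e * (e + 1) * (e ^+ 3 + e ^+ 2 + 1))
    (- (e * (e ^+ 6 + e ^+ 5 + 2 * e ^+ 4 + 2 * e ^+ 3 + e ^+ 2 + e + 1)))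
    _ _ _ _ char2 eR).
  by ring.
have eq2 : e ^+ q = e ^+ 2 by rewrite /q (expf_pow2_mod3 _ e8) m1.
have eqq : e ^+ q ^+ q = e ^+ 4 by rewrite eq2 exprAC eq2 -exprM.
have tre : tr e = 0.
  rewrite trE eqq eq2.
  have -> : e + e ^+ 2 + e ^+ 4 = e * (e ^+ 3 + e + 1) by ring.
  by rewrite eR mulr0.
rewrite trD tre addr0 exprqD eq2 trE !expr1n.
apply: (@lincomb_pchar2 _ e
  (4 * e ^+ 4 + 9 * e ^+ 3 + 22 * e ^+ 2 + 18 * e) _ _ _ _ char2 eR).
by ring.
Qed.

End CubicExtension.

Theorem theorem3p4 (m q : nat) (F : finFieldType)
    (m_gt0 : (0 < m)%N) (qE : q = (2 ^ m)%N) (cardF : #|F| = (q ^ 3)%N) :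
  permutation_poly
    ('X + 'X^(2 * q ^ 2 + 2 * q) + 'X^(2 * q ^ 2 + 2) + 'X^4 + 'X^(4 * q)
      : {poly F})
  <-> ~ (m = 1 %[mod 3])%N.
Proof.
subst q; have c2 := pchar2_cubic cardF.
split=> [/bij_inj injf m1 | m1].
  have [e e0 fe] := trace_form_collision cardF m1.
  case/eqP: e0; apply: (addrI 1); rewrite addr0; apply: injf.
  by rewrite !horner_trace_form.
apply: injF_bij => x y; rewrite !horner_trace_form // => fxy.
apply/eqP; apply: contra_notT m1 => neq_xy.
have [e e0 [tre eq2]] := frobenius_square_witness cardF fxy neq_xy.
exact: frobenius_square_mod3 e0 tre eq2.
Qed.
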